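(* Let $m\geq 3$ and $n\geq 2$ be integers, and let $\mathbb{P}_m(n)$ be the undirected generalized pancake graph. Then \[ \gamma(\mathbb{P}_m(n))\leq \begin{cases} \frac{1}{2}m^{n-1}(mn-m-n)\,n!+1, & \text{if } m \text{ is even},\\[2pt] \frac{1}{2}m^{n-1}(2mn-2m-n-1)\,n!+1, & \text{if } m \text{ is odd}. \end{cases} \]
   Context: For a graph $G$, $\gamma(G)$ denotes its genus: the minimum genus of a closed orientable surface on which $G$ can be embedded without edge crossings. Let $S(m,n)=C_m\wr S_n$ be the generalized symmetric group. Its elements are written $\pi_1^{a_1}\pi_2^{a_2}\cdots\pi_n^{a_n}$, where $\pi_1\cdots\pi_n$ is a permutation of $[n]$ and each sign $a_j\in\{0,1,\dots,m-1\}$. For $1\le i\le n$ the flip $r_i$ is defined by \[ r_i(\pi_1^{a_1}\cdots\pi_n^{a_n})=\pi_i^{b_i}\pi_{i-1}^{b_{i-1}}\cdots\pi_1^{b_1}\pi_{i+1}^{a_{i+1}}\cdots\pi_n^{a_n}, \] with $b_j=a_j+1 \pmod m$. The undirected generalized pancake graph $\mathbb{P}_m(n)$ has vertex set $S(m,n)$. Vertices $v,w$ are adjacent iff $w=r_i(v)$ or $v=r_i(w)$ for some $1\le i\le n$. For $m\ge 3$ it has $m^n n!$ vertices and $m^n n!\,n$ edges. *)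

(* Defs.v *)
From HB Require Import structures.
From mathcomp Require Import all_boot all_order all_algebra all_fingroup.
From mathcomp Require Import all_classical all_reals all_analysis.
Import numFieldNormedType.Exports.
Import Order.TTheory GRing.Theory Num.Theory.

Set Implicit Arguments.
Unset Strict Implicit.
Unset Printing Implicit Defensive.

Local Open Scope set_scope.

(** ** Finite simplicial complexes *)

(* A complex is the set of its nonempty simplices, each given by its vertices;
   every element of [V] is a vertex. *)
Definition simplicial_complex (V : finType) (K : {set {set V}}) : Prop :=
  [/\ finset.set0 \notin K,
      forall v : V, [set v] \in K
    & forall s t : {set V}, t \in K -> s \subset t -> s != finset.set0 -> s \in K].

(* Barycentric coordinates, as a subset of R^V with the product topology; the
   coercion of a set to the type of its elements gives it the subspace
   topology. *)
Definition realization (R : realType) (V : finType) (K : {set {set V}}) :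
    classical_sets.set {ptws V -> R} :=
  (fun x : V -> R => [/\ forall v, (0 <= x v)%R,
      (\sum_(v : V) x v = 1)%R
    & [set v | x v != 0%R] \in K]).
Arguments realization R {V} K.

Definition polyhedron (R : realType) (V : finType) (K : {set {set V}}) :
    topologicalType :=
  set_type (realization R K).

Definition euler_char (V : finType) (K : {set {set V}}) : int :=
  (\sum_(s in K) (-1) ^+ #|s|.-1)%R.

(** ** Closed orientable surfaces *)

Definition link_rel (V : finType) (K : {set {set V}}) (v : V) : rel V :=
  fun a b => ([set v; a; b] \in K) && (#|[set v; a; b]| == 3).

(* A nonempty connected complex, pure of dimension 2, in which every edge lies
   in exactly two triangles and every vertex link is connected. By the condition
   on edges links are 2-regular, so that a connected link is a circle. *)
Definition closed_surface_complex (V : finType) (K : {set {set V}}) : Prop :=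
  [/\ simplicial_complex K,
      0 < #|V| /\ (forall a b : V, connect (fun x y => [set x; y] \in K) a b),
      forall s, s \in K -> exists t, [/\ t \in K, s \subset t & #|t| = 3],
      forall s, s \in K -> #|s| = 2 ->
        #|[set t in K | (s \subset t) && (#|t| == 3)]| = 2
    & forall v a b : V, a != v -> b != v ->
        [set v; a] \in K -> [set v; b] \in K -> connect (link_rel K v) a b].

(* [o a b c] says that the triangle abc is oriented as (a, b, c). Triangles
   sharing an edge must induce opposite orientations on it. *)
Definition orientable_complex (V : finType) (K : {set {set V}}) : Prop :=
  exists o : V -> V -> V -> bool,
    (forall a b c : V, [set a; b; c] \in K -> #|[set a; b; c]| = 3 ->
       o b c a = o a b c /\ o b a c = ~~ o a b c) /\
    (forall a b c d : V, [set a; b; c] \in K -> #|[set a; b; c]| = 3 ->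
       [set a; b; d] \in K -> #|[set a; b; d]| = 3 -> c != d ->
       o a b d = ~~ o a b c).

Definition homeomorphic (S T : topologicalType) : Prop :=
  exists (f : S -> T) (h : T -> S),
    [/\ continuous f, continuous h, cancel f h & cancel h f].

(* Closed surfaces are taken with their triangulations, which exist by Radó's
   theorem, and the genus g is given by the Euler characteristic 2 - 2g. *)
Definition closed_orientable_surface (R : realType) (g : nat)
    (S : topologicalType) : Prop :=
  exists (V : finType) (K : {set {set V}}),
    [/\ closed_surface_complex K, orientable_complex K,
        (euler_char K = 2 - 2 * g%:Z)%R
      & homeomorphic S (polyhedron R K)].

(** ** Genus of a graph *)

Definition topological_embedding (S T : topologicalType) (f : S -> T) : Prop :=
  injective f /\
  (forall A : classical_sets.set S,
     open A <-> exists2 B : classical_sets.set T, open B & (f @^-1` B)%classic = A).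

(* The simple graph with adjacency relation [e] as a 1-dimensional complex. *)
Definition graph_complex (T : finType) (e : rel T) : {set {set T}} :=
  [set s : {set T} | (#|s| == 1) ||
     [exists x : T, exists y : T, e x y && (s == [set x; y])]].

Definition embeds_in_genus (R : realType) (T : finType) (e : rel T) (g : nat)
    : Prop :=
  exists S : topologicalType, closed_orientable_surface R g S /\
    exists f : polyhedron R (graph_complex e) -> S, topological_embedding f.

Definition is_genus (R : realType) (T : finType) (e : rel T) (g : nat) : Prop :=
  embeds_in_genus R e g /\ (forall h : nat, embeds_in_genus R e h -> g <= h).

(** ** Generalized pancake graphs *)

(* (p, a) is the word p_1^{a_1} ... p_n^{a_n}: the letter at position j is [p j],
   with sign [a j]. 'Z_m is the integers modulo m only for m > 1. *)
Definition signed_perm (m n : nat) : finType :=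
  ('S_n * {ffun 'I_n -> 'Z_m})%type.

Lemma rev_prefix_subproof (n : nat) (i j : 'I_n) :
  (if j <= i then i - j else j) < n.
Proof.
by case: ifP => // _; apply: leq_ltn_trans (leq_subr _ _) (ltn_ord i).
Qed.

Definition rev_prefix_fun (n : nat) (i j : 'I_n) : 'I_n :=
  Ordinal (rev_prefix_subproof i j).

Lemma rev_prefix_inj (n : nat) (i : 'I_n) : injective (rev_prefix_fun i).
Proof.
apply: inv_inj => j; apply: val_inj => /=.
by have [ji|ij] := leqP j i; rewrite ?leq_subr ?subKn // leqNgt ij.
Qed.

Definition rev_prefix (n : nat) (i : 'I_n) : 'S_n := perm (@rev_prefix_inj n i).

(* Positions are counted from 0, so that [flip i] is r_(i+1). In the product of
   permutations the left factor acts first: the new letter at position j is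
   [p (rev_prefix i j)]. *)
Definition flip (m n : nat) (i : 'I_n) (w : signed_perm m n) : signed_perm m n :=
  ((rev_prefix i * w.1)%g,
   [ffun j : 'I_n =>
      if j <= i then (w.2 (rev_prefix i j) + 1)%R else w.2 j]).

Definition pancake_adj (m n : nat) : rel (signed_perm m n) :=
  fun v w => [exists i : 'I_n, (w == flip i v) || (v == flip i w)].

(* Main.v *)
(** Every edge w -- r_i(w) carries two darts (w, i, +), running from w to r_i(w),
    and (w, i, -), running from w to r_i^-1(w). In the rotation system in which
    the darts with sign + out of w alternate with those with sign -, the faces to
    the left of the positive darts are the cycles of the r_i, and those to the left
    of the negative darts spell the word r_1^-1 r_2^-1 ... r_n^-1 repeatedly. With
    F faces the Euler characteristic is V - nV + F for V = m^n n!. It is even by a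
    signature argument, and it is at most 0 since the faces are long enough (lengths
    at least 3; for n = 2 the reciprocals of the face lengths at the darts out of a
    vertex sum to at most 1). Hence the genus of this embedding is
    1 + (nV - V - F) / 2. For m even all r_i have order m, so F >= nV / m, which is
    the bound; for m odd the bound already follows from F >= 0. *)
Require Import Defs.
From mathcomp Require Import all_boot all_order all_algebra all_fingroup.
From mathcomp Require Import all_classical all_reals all_analysis.
From mathcomp Require Import zify ring lra.
Import numFieldNormedType.Exports.
Import Order.TTheory GRing.Theory Num.Theory.

Set Implicit Arguments.
Unset Strict Implicit.
Unset Printing Implicit Defensive.

Local Open Scope ring_scope.

(** * Triangulated surfaces *)

Lemma cards3 (T : finType) (a b c : T) :
  (#|[set a; b; c]%SET| == 3) = [&& a != b, a != c & b != c].
Proof.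
rewrite -finset.setUA cardsU1 cards2 !inE negb_or.
by case: (a != b); case: (a != c); case: (b != c).
Qed.

Section OrientedTriangles.
Local Open Scope nat_scope.
Local Open Scope set_scope.
Variables (W : finType) (o : W -> W -> W -> bool).

(** [o a b c] reads: the triangle to the left of the directed edge ab has third vertex c. Then
    [o_uniq] and [o_opp] put exactly one triangle on each side of an edge, and [o_chiral] makes the
    two different. *)
Definition triangle_complex : {set {set W}} :=
  [set s : {set W} | (s != finset.set0) &&
     [exists a, exists b, exists c, o a b c && (s \subset [set a; b; c])]].

Hypothesis o_rot : forall a b c, o a b c -> o b c a.
Hypothesis o_uniq : forall a b c d, o a b c -> o a b d -> c = d.
Hypothesis o_opp : forall a b c, o a b c -> exists d, o b a d.
Hypothesis o_neq : forall a b c, o a b c -> a != b.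
Hypothesis o_chiral : forall a b c, o a b c -> ~~ o b a c.

Arguments o_rot {a b c}.
Arguments o_uniq {a b c d}.
Arguments o_opp {a b c}.
Arguments o_neq {a b c}.
Arguments o_chiral {a b c}.

Lemma triangle_complexP s :
  reflect (s != finset.set0 /\
           exists a b c, o a b c /\ {subset s <= [set a; b; c]})
          (s \in triangle_complex).
Proof.
rewrite inE; apply: (iffP andP) => -[s0].
  by move=> /existsP[a /existsP[b /existsP[c /andP[abc /fintype.subsetP ss]]]];
    split=> //; exists a, b, c.
move=> [a [b [c [abc ss]]]]; split=> //.
by apply/existsP; exists a; apply/existsP; exists b; apply/existsP; exists c;
  rewrite abc; apply/fintype.subsetP.
Qed.

Lemma oriented_card3 a b c : o a b c -> #|[set a; b; c]| = 3.
Proof.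
move=> abc; apply/eqP; rewrite cards3 (o_neq abc) (o_neq (o_rot abc)).
by rewrite eq_sym (o_neq (o_rot (o_rot abc))).
Qed.

(** Of the six ordered pairs of corners, three follow the cyclic order and three run against it. *)
Lemma oriented_edge x y z a b : o x y z -> a \in [set x; y; z] ->
  b \in [set x; y; z] -> a != b ->
  exists c, [set x; y; z] = [set a; b; c] /\ (o a b c \/ o b a c).
Proof.
move=> xyz; have yzx := o_rot xyz; have zxy := o_rot yzx.
have perm (p q r : W) : [set x; y; z] =i [set p; q; r] ->
    o p q r \/ o q p r ->
    exists c, [set x; y; z] = [set p; q; c] /\ (o p q c \/ o q p c).
  by move=> pqr H; exists r; split=> //; apply/setP.
rewrite !inE -!orbA => /or3P[]/eqP-> /or3P[]/eqP->; rewrite ?eqxx // => _.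
- by apply: (perm _ _ z) => //; left.
- by apply: (perm _ _ y); [move=> u; rewrite !inE orbAC | right].
- by apply: (perm _ _ z); [move=> u; rewrite !inE (orbC (u == x)) | right].
- by apply: (perm _ _ x); [move=> u; rewrite !inE -orbA orbC | left].
- by apply: (perm _ _ y); [move=> u; rewrite !inE orbC orbA | left].
- by apply: (perm _ _ x); [move=> u; rewrite !inE orbC orbA orbAC | right].
Qed.

Lemma triangle_complex_edge a b : a != b -> [set a; b] \in triangle_complex ->
  exists c, o a b c.
Proof.
move=> ab /triangle_complexP[_ [x [y [z [xyz ss]]]]].
have [||c [_ [?|/o_opp //]]] := @oriented_edge x y z a b xyz _ _ ab;
  by [apply: ss; rewrite !inE eqxx ?orbT | exists c].
Qed.

Lemma oriented_mem a b c s : o a b c -> s != finset.set0 ->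
  {subset s <= [set a; b; c]} -> s \in triangle_complex.
Proof. by move=> abc s0 ss; apply/triangle_complexP; split=> //; exists a, b, c. Qed.

Lemma oriented_edge_mem a b c : o a b c -> [set a; b] \in triangle_complex.
Proof.
move=> abc; apply: (oriented_mem abc); last by move=> u; rewrite !inE => ->.
by apply/set0Pn; exists a; rewrite !inE eqxx.
Qed.

Lemma oriented_triangle_mem a b c : o a b c -> [set a; b; c] \in triangle_complex.
Proof.
move=> abc; apply: (oriented_mem abc) => //.
by apply/set0Pn; exists a; rewrite !inE eqxx.
Qed.

Lemma triangle_complex_face s : s \in triangle_complex -> #|s| = 3 ->
  exists a b c, o a b c /\ s = [set a; b; c].
Proof.
move=> /triangle_complexP[_ [a [b [c [abc ss]]]]] s3; exists a, b, c; split=> //.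
by apply/eqP; rewrite eqEcard s3 oriented_card3 // leqnn andbT; apply/fintype.subsetP.
Qed.

Lemma triangle_complex_triangle a b c : #|[set a; b; c]| = 3 ->
  [set a; b; c] \in triangle_complex -> o a b c \/ o b a c.
Proof.
move=> abc K; have /and3P[ab ac bc] : [&& a != b, a != c & b != c] by rewrite -cards3 abc.
have [x [y [z [xyz E]]]] := triangle_complex_face K abc.
have [||d [E' od]] := @oriented_edge x y z a b xyz _ _ ab;
  [by rewrite -E !inE eqxx ?orbT.. |].
suff -> : c = d by [].
have : c \in [set a; b; d] by rewrite -E' -E !inE eqxx orbT.
by rewrite !inE ![c == _]eq_sym (negPf ac) (negPf bc) => /eqP.
Qed.

(** The orientation is [o] itself. If neither of two triangles at ab lies to the left of ab, both
    lie to the left of ba, and [o_uniq] identifies them. *)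
Lemma triangle_complex_orientable : orientable_complex triangle_complex.
Proof.
exists o; split=> [a b c K abc | a b c d Kc abc Kd abd cd].
  have rot3 : o b c a = o a b c by apply/idP/idP; [move=> /o_rot/o_rot | apply: o_rot].
  split=> //; have [h|h] := triangle_complex_triangle abc K.
    by rewrite h; apply/negbTE/o_chiral.
  by rewrite h; apply/esym/o_chiral.
have [h|h] := triangle_complex_triangle abc Kc.
  rewrite h; apply/negP => /(o_uniq h) /eqP; exact/negP.
rewrite (o_chiral h); have [//|/(o_uniq h) E] := triangle_complex_triangle abd Kd.
by rewrite E eqxx in cd.
Qed.

Hypothesis o_cover : forall a, exists b c, o a b c.

Lemma triangle_complex_simplicial : simplicial_complex triangle_complex.
Proof.
split=> [|v|s t /triangle_complexP[_ [a [b [c [abc tt]]]]] /fintype.subsetP st s0].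
- by rewrite inE eqxx.
- have [b [c vbc]] := o_cover v; apply: (oriented_mem vbc).
    by apply/set0Pn; exists v; rewrite inE.
  by move=> u; rewrite !inE => ->.
- by apply: (oriented_mem abc s0) => u /st /tt.
Qed.

Lemma triangle_complex_closed_surface : 0 < #|W| ->
  (forall a b, connect (fun x y => [exists z, o x y z]) a b) ->
  (forall v a b c d, o v a c -> o v b d ->
     connect (fun x y => o v x y || o v y x) a b) ->
  closed_surface_complex triangle_complex.
Proof.
move=> W0 o_conn o_link; split.
- exact: triangle_complex_simplicial.
- split=> // a b; apply: connect_sub (o_conn a b) => x y /existsP[z xyz].
  by apply: connect1; apply: (oriented_edge_mem xyz).
- move=> s /triangle_complexP[_ [a [b [c [abc ss]]]]]; exists [set a; b; c].
  split; [exact: oriented_triangle_mem | exact/fintype.subsetP | exact: oriented_card3].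
- move=> s sK /eqP/cards2P[a [b [ab E]]]; rewrite {}E in sK *.
  have [c abc] := triangle_complex_edge ab sK; have [d bad] := o_opp abc.
  (* The two triangles at the edge are the one to the left of ab and the one to the left of ba; a
     common third vertex would contradict chirality. *)
  suff -> : [set t in triangle_complex | ([set a; b] \subset t) && (#|t| == 3)]
            = [set [set a; b; c]; [set b; a; d]].
    rewrite cards2 -[RHS]/(true.+1); congr (nat_of_bool _).+1; apply/eqP => E.
    have : c \in [set b; a; d] by rewrite -E !inE eqxx ?orbT.
    have bca := o_rot abc; rewrite !inE (negPf (o_neq (o_rot bca))).
    rewrite eq_sym (negPf (o_neq bca)) => /eqP cd.
    by move: bad; rewrite -cd; apply/negP/o_chiral.
  apply/setP => t; rewrite [LHS]inE !inE -[_ && _]/(_ && _).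
  apply/idP/idP => [/andP[tK /andP[/fintype.subsetP abt /eqP t3]]|/orP[]/eqP->].
  + have [x [y [z [xyz E]]]] : exists x y z, o x y z /\ t = [set x; y; z].
      by apply: triangle_complex_face => //; rewrite inE.
    have [||e [E' [h|h]]] := @oriented_edge x y z a b xyz _ _ ab;
      [by rewrite -E; apply: abt; rewrite !inE eqxx ?orbT.. | |].
      by rewrite E E' (o_uniq abc h) eqxx.
    by rewrite E E' (o_uniq bad h) (finset.setUC [set a]) eqxx orbT.
  + move: (oriented_triangle_mem abc); rewrite inE => ->.
    by rewrite (oriented_card3 abc) eqxx finset.subsetUl.
  + move: (oriented_triangle_mem bad); rewrite inE => ->.
    by rewrite (oriented_card3 bad) eqxx (finset.setUC [set a]) finset.subsetUl.
- move=> v a b; rewrite ![_ == v]eq_sym => va vb.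
  move=> /(triangle_complex_edge va)[c vac] /(triangle_complex_edge vb)[d vbd].
  apply: connect_sub (o_link _ _ _ _ _ vac vbd) => x y vxy; apply: connect1.
  rewrite /link_rel; case/orP: vxy => h; first by rewrite oriented_triangle_mem // oriented_card3.
  have -> : [set v; x; y] = [set v; y; x] by apply/setP => u; rewrite !inE orbAC.
  by rewrite oriented_triangle_mem // oriented_card3.
Qed.

(** Double counting of the N triples in [o]: each edge carries two, one per direction, and each
    triangle three, its rotations. So N = 2E = 3F, and V - E + F = V - N/6. *)
Lemma triangle_complex_euler :
  (euler_char triangle_complex *+ 6 =
     #|W|%:R *+ 6 - #|[set p : W * W * W | o p.1.1 p.1.2 p.2]|%:R :> int)%R.
Proof.
pose K i := [set s in triangle_complex | #|s| == i].
set N := #|_|.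
have K1 : #|K 1| = #|W|.
  rewrite -cardsT -(card_imset _ (@finset.set1_inj W)); apply: eq_card => s.
  apply/idP/imsetP => [|[v _ ->]]; first by rewrite inE => /andP[_ /cards1P[v ->]]; exists v.
  by have [_ + _] := triangle_complex_simplicial; move=> /(_ v); rewrite !inE cards1 => ->.
have count (f : W * W * W -> {set W}) i k :
    (forall p, o p.1.1 p.1.2 p.2 -> f p \in K i) ->
    (forall s, s \in K i -> #|[set p : W * W * W | o p.1.1 p.1.2 p.2 && (f p == s)]| = k) ->
    N = #|K i| * k.
  move=> fK fk; rewrite /N -sum1dep_card (partition_big f (mem (K i))) //=.
  rewrite -sum_nat_const; apply: eq_bigr => s /fk <-.
  by rewrite -sum1dep_card.
have K2 : N = #|K 2| * 2.
  apply: (count (fun p => [set p.1.1; p.1.2])) => [[[a b] c] /= abc|s].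
    by rewrite inE (oriented_edge_mem abc) cards2 (o_neq abc).
  rewrite inE => /andP[sK /cards2P[a [b [ab E]]]]; rewrite {}E in sK *.
  have [c abc] := triangle_complex_edge ab sK; have [d bad] := o_opp abc.
  suff -> : [set p : W * W * W | o p.1.1 p.1.2 p.2 && ([set p.1.1; p.1.2] == [set a; b])]
      = [set (a, b, c); (b, a, d)].
    by rewrite cards2 !xpair_eqE (negPf ab).
  apply/setP => -[[x y] z]; rewrite !inE !xpair_eqE /=.
  apply/idP/idP => [/andP[xyz /eqP E]|/orP[]/andP[/andP[/eqP-> /eqP->] /eqP->]].
  + have : x \in [set a; b] by rewrite -E !inE eqxx.
    have : y \in [set a; b] by rewrite -E !inE eqxx orbT.
    have xy := o_neq xyz.
    rewrite !inE => /orP[]/eqP ey /orP[]/eqP ex; rewrite ex ey ?eqxx // in xyz xy *.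
      by rewrite (o_uniq bad xyz) eqxx orbT.
    by rewrite (o_uniq abc xyz) eqxx.
  + by rewrite abc eqxx.
  + by rewrite bad finset.setUC eqxx.
have K3 : N = #|K 3| * 3.
  apply: (count (fun p => [set p.1.1; p.1.2; p.2])) => [[[a b] c] /= abc|s].
    by rewrite inE (oriented_triangle_mem abc) oriented_card3.
  rewrite inE => /andP[sK /eqP s3].
  have [a [b [c [abc E]]]] := triangle_complex_face sK s3; rewrite {}E in sK s3 *.
  have bca := o_rot abc; have cab := o_rot bca.
  have /and3P[ab ac bc] : [&& a != b, a != c & b != c] by rewrite -cards3 s3.
  suff -> : [set p : W * W * W | o p.1.1 p.1.2 p.2 &&
      ([set p.1.1; p.1.2; p.2] == [set a; b; c])]
      = [set (a, b, c); (b, c, a); (c, a, b)].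
    apply/eqP; rewrite cards3 !xpair_eqE (negPf ab) (negPf bc) (eq_sym a c).
    by rewrite eq_sym (negPf ac).
  apply/setP => -[[x y] z]; rewrite !inE !xpair_eqE /=.
  apply/idP/idP => [/andP[xyz /eqP E]|/orP[/orP[]|]/andP[/andP[/eqP-> /eqP->] /eqP->]].
  + have xS : x \in [set a; b; c] by rewrite -E !inE eqxx.
    have yS : y \in [set a; b; c] by rewrite -E !inE eqxx orbT.
    have zS : z \in [set a; b; c] by rewrite -E !inE eqxx orbT.
    have xy := o_neq xyz; have yz := o_neq (o_rot xyz); have zx := o_neq (o_rot (o_rot xyz)).
    have [na [nb nc]] : ~~ o b a c /\ ~~ o c b a /\ ~~ o a c b.
      by rewrite !o_chiral.
    move: xyz xy yz zx; move: xS yS zS; rewrite !inE -!orbA.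
    by move=> /or3P[]/eqP-> /or3P[]/eqP-> /or3P[]/eqP->;
      rewrite ?eqxx ?orbT ?(negPf na) ?(negPf nb) ?(negPf nc) //.
  + by rewrite abc eqxx.
  + by rewrite bca; apply/eqP/setP => u; rewrite !inE; do 3!case: (u == _).
  + by rewrite cab; apply/eqP/setP => u; rewrite !inE; do 3!case: (u == _).
have E : (euler_char triangle_complex = #|K 1|%:R - #|K 2|%:R + #|K 3|%:R)%R.
  have cK i : (#|K i|%:R = \sum_(s in triangle_complex) (#|s| == i)%:R :> int)%R.
    by rewrite -natr_sum /K -sum1dep_card big_mkcondr /=; congr (_%:R)%R.
  rewrite !cK -sumrB -big_split; apply: eq_bigr => s sK /=.
  have : 0 < #|s| <= 3.
    move/triangle_complexP: sK => [s0 [a [b [c [abc /fintype.subsetP/subset_leq_card]]]]].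
    by rewrite (oriented_card3 abc) lt0n cards_eq0 s0.
  by case: #|s| => [|[|[|[|k]]]].
rewrite E K1 {count}; by move: N #|K 2| #|K 3| K2 K3 => N' e t ->; lia.
Qed.

End OrientedTriangles.

(** * Subcomplexes *)

Section SubcomplexEmbedding.
Local Open Scope classical_set_scope.

Lemma ptws_continuous (R : realType) (S : topologicalType) (V : finType)
    (f : S -> {ptws V -> R}) :
  (forall v, continuous (fun s => f s v)) -> continuous f.
Proof.
move=> fc s; apply/cvg_sup => v U [X] [[Y] oY <-] Yfs YU.
apply: (filterS YU); apply: (fc v s Y).
by apply: open_nbhs_nbhs.
Qed.

(** Extending barycentric coordinates by zero is continuous and has restriction along [i] as a
    continuous left inverse, hence is an embedding. *)
Lemma subcomplex_embedding (R : realType) (V V' : finType) (i : V -> V')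
    (K : {set {set V}}) (K' : {set {set V'}}) :
  injective i -> (forall s : {set V}, s \in K -> [set i v | v in s]%SET \in K') ->
  exists f : polyhedron R K -> polyhedron R K', topological_embedding f.
Proof.
move=> i_inj KK'.
(* The fibre of [w] has at most one point, so this is a coordinate of [x] on the image of [i] and 0
   elsewhere. *)
pose ext (x : {ptws V -> R}) : {ptws V' -> R} := fun w => \sum_(v | i v == w) x v.
pose res (y : {ptws V' -> R}) : {ptws V -> R} := fun v => y (i v).
have extE x v : ext x (i v) = x v.
  by rewrite /ext (eq_bigl (pred1 v)) ?big_pred1_eq // => u; rewrite /= (inj_eq i_inj).
have ext0 x w : (forall v, i v != w) -> ext x w = 0.
  by move=> nw; rewrite /ext big1 // => v; rewrite (negPf (nw v)).
have extK : cancel ext res by move=> x; apply/funext => v; exact: extE.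
have ext_cont : continuous ext.
  apply: ptws_continuous => w.
  have [[v <-]|nw] := pselect (exists v, i v = w).
    rewrite (_ : (fun _ => _) = (fun x : {ptws V -> R} => x v)); last first.
      by apply/funext => x; exact: extE.
    exact: (@proj_continuous V (fun=> R) v).
  rewrite (_ : (fun _ => _) = (fun=> 0)); first exact: cst_continuous.
  by apply/funext => x; apply: ext0 => v; apply/eqP => vw; apply: nw; exists v.
have res_cont : continuous res.
  by apply: ptws_continuous => v; exact: (@proj_continuous V' (fun=> R) (i v)).
have ext_real (x : {ptws V -> R}) : realization R K x -> realization R K' (ext x).
  move=> [x0 x1 xK]; split.
  - by move=> w; apply: sumr_ge0 => v _; exact: x0.
  - by rewrite -x1 [RHS](partition_big i xpredT).
  - suff -> : [set w | ext x w != 0]%SET = [set i v | v in [set v | x v != 0]]%SET by exact: KK'.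
    apply/setP => w; rewrite inE; apply/idP/imsetP.
      have [[v <-]|nw] := pselect (exists v, i v = w).
        by rewrite extE => xv; exists v; rewrite ?inE.
      by rewrite ext0 ?eqxx // => v; apply/eqP => vw; apply: nw; exists v.
    by move=> [v]; rewrite inE => xv ->; rewrite extE.
exists (fun x => SigSub (mem_set (ext_real _ (set_mem (valP x))))); split.
  move=> x y /(congr1 set_val) /= /(can_inj extK); exact: val_inj.
move=> A; split.
  move=> [U oU <-]; exists (set_val @^-1` (res @^-1` U)).
    by exists (res @^-1` U) => //; apply: open_comp => // x _; exact: res_cont.
  by apply/seteqP; split => x; rewrite /preimage /= extK.
move=> [B [U oU <-] <-]; exists (ext @^-1` U) => //.
by apply: open_comp => // x _; exact: ext_cont.
Qed.

End SubcomplexEmbedding.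

(** * Rotation systems *)

Section RotationSystem.
Local Open Scope nat_scope.
Local Open Scope set_scope.
Variables (T D F : finType) (src : D -> T) (rev : D -> D) (phi : {perm D}).
Variable (face : D -> F).

Local Notation dst d := (src (rev d)).
Local Notation W := (T + D + F)%type.

(* The face to the left of the dart d is coned from its centre F, after a collar
   of corners (one corner D per dart) has been inserted, so that faces whose
   boundary walk is not a simple cycle are triangulated as well. *)
Definition dart_triangle (a b c : W) : bool :=
  match a, b, c with
  | inl (inl u), inl (inl v), inl (inr d)
  | inl (inl v), inl (inr d), inl (inl u)
  | inl (inr d), inl (inl u), inl (inl v) => (u == src d) && (v == dst d)
  | inl (inr d), inl (inl v), inl (inr e)
  | inl (inl v), inl (inr e), inl (inr d)
  | inl (inr e), inl (inr d), inl (inl v) => (v == dst d) && (e == phi d)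
  | inl (inr d), inl (inr e), inr f
  | inl (inr e), inr f, inl (inr d)
  | inr f, inl (inr d), inl (inr e) => (e == phi d) && (f == face d)
  | _, _, _ => false
  end.

Hypothesis revK : involutive rev.
Hypothesis dart_inj : forall d e, src d = src e -> dst d = dst e -> d = e.
Hypothesis src_neq_dst : forall d, src d != dst d.
Hypothesis src_phi : forall d, src (phi d) = dst d.
Hypothesis phi2_neq : forall d, phi (phi d) != d.
Hypothesis face_phi : forall d, face (phi d) = face d.

Lemma dart_triangle_rot a b c : dart_triangle a b c -> dart_triangle b c a.
Proof. by case: a => [[?|?]|?]; case: b => [[?|?]|?]; case: c => [[?|?]|?]. Qed.

(** A vertex and a corner, or two corners, may bound triangles of two different kinds. Both kinds on
    the same side would force [src x = dst x] or [phi (phi x) = x]. Within one kind, [dart_inj] or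
    injectivity of [phi] decides. *)
Lemma dart_triangle_uniq a b c d :
  dart_triangle a b c -> dart_triangle a b d -> c = d.
Proof.
have sdF x : src x = dst x -> False by apply/eqP; exact: src_neq_dst.
have phiF x : x = phi (phi x) -> False by apply/eqP; rewrite eq_sym phi2_neq.
case: a => [[a|a]|a]; case: b => [[b|b]|b] //; case: c => [[c|c]|c] //;
  case: d => [[d|d]|d] //=; move=> /andP[/eqP h1 /eqP h2] /andP[/eqP h3 /eqP h4];
  try by congruence.
- by congr (inl (inr _)); apply: dart_inj; congruence.
- by congr (inl (inr _)); apply: (@perm_inj _ phi); congruence.
- by congr (inl (inr _)); apply: (@perm_inj _ phi); congruence.
Qed.

(** Across a graph edge lies the triangle of the reversed dart. All other edges are interior to a
    face, and the neighbour belongs to the same dart or to its successor or predecessor under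
    [phi]. *)
Lemma dart_triangle_opp a b c : dart_triangle a b c -> exists d, dart_triangle b a d.
Proof.
case: a => [[a|a]|a]; case: b => [[b|b]|b] //; case: c => [[c|c]|c] //=;
  move=> /andP[/eqP h1 /eqP h2]; subst.
- by exists (inl (inr (rev c))); rewrite /= revK !eqxx.
- by exists (inl (inr (phi b))); rewrite /= !eqxx.
- by exists (inl (inl (dst (phi c)))); rewrite /= src_phi !eqxx.
- exists (inl (inr (phi^-1%g a))).
  by rewrite /= -src_phi permKV !eqxx.
- by exists (inl (inl (src a))); rewrite /= !eqxx.
- by exists (inr (face b)); rewrite /= !eqxx.
- by exists (inl (inl (dst a))); rewrite /= !eqxx.
- by exists (inl (inr (phi (phi c)))); rewrite /= face_phi !eqxx.
- by exists (inl (inr (phi^-1%g b))); rewrite /= -(face_phi (phi^-1%g b)) permKV !eqxx.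
Qed.

Lemma dart_triangle_neq a b c : dart_triangle a b c -> a != b.
Proof.
have phi_neq x : phi x != x.
  by apply: contraNneq (src_neq_dst x) => e; rewrite -src_phi e.
case: a => [[a|a]|a]; case: b => [[b|b]|b] //; case: c => [[c|c]|c] //=;
  move=> /andP[/eqP h1 /eqP h2]; subst; apply: contraTneq isT => -[].
- by move/eqP; rewrite (negPf (src_neq_dst _)).
- by move/eqP; rewrite (negPf (phi_neq _)).
- by move/esym/eqP; rewrite (negPf (phi_neq _)).
Qed.

Lemma dart_triangle_chiral a b c : dart_triangle a b c -> ~~ dart_triangle b a c.
Proof.
have sdF x : src x = dst x -> False by apply/eqP; exact: src_neq_dst.
have phiF x : x = phi (phi x) -> False by apply/eqP; rewrite eq_sym phi2_neq.
case: a => [[a|a]|a]; case: b => [[b|b]|b] //; case: c => [[c|c]|c] //=;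
  move=> /andP[/eqP h1 /eqP h2]; apply/negP => /andP[/eqP h3 /eqP h4];
  first [by case: (sdF a); congruence | by case: (sdF b); congruence
    | by case: (sdF c); congruence | by case: (phiF a); congruence
    | by case: (phiF b); congruence | by case: (phiF c); congruence].
Qed.

Hypothesis face_orbit : forall d e, face d = face e -> e \in porbit phi d.
Hypothesis face_surj : forall f, exists d, face d = f.
Hypothesis src_surj : forall v, exists d, src d = v.
Hypothesis rotation : forall d e, src d = src e ->
  connect (fun x y => y == phi (rev x)) d e.
Hypothesis dart_connected : forall u v,
  connect (fun x y => [exists d, (src d == x) && (dst d == y)]) u v.

Local Notation rT d := (inl (inl d) : W).
Local Notation rC d := (inl (inr d) : W).
Local Notation rF f := (inr f : W).

Lemma dart_triangle_vertex d : dart_triangle (rT (src d)) (rT (dst d)) (rC d).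
Proof. by rewrite /= !eqxx. Qed.

Lemma dart_triangle_corner d : dart_triangle (rC d) (rT (dst d)) (rC (phi d)).
Proof. by rewrite /= !eqxx. Qed.

Lemma dart_triangle_face d : dart_triangle (rC d) (rC (phi d)) (rF (face d)).
Proof. by rewrite /= !eqxx. Qed.

Lemma dart_triangle_cover a : exists b c, dart_triangle a b c.
Proof.
case: a => [[u|d]|f].
- by have [d <-] := src_surj u; do 2!eexists; exact: dart_triangle_vertex.
- by do 2!eexists; exact: dart_triangle_corner.
- have [d <-] := face_surj f; exists (rC d), (rC (phi d)).
  by rewrite /= !eqxx.
Qed.

Lemma dart_triangle_connected a b :
  connect (fun x y => [exists z, dart_triangle x y z]) a b.
Proof.
set e := (X in connect X).
have esym : connect_sym e.
  apply: sym_connect_sym => x y.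
  by apply/idP/idP => /existsP[z /dart_triangle_opp[t h]]; apply/existsP; exists t.
have step x y z : dart_triangle x y z -> connect e x y.
  by move=> h; apply: connect1; apply/existsP; exists z.
have TT u v : connect e (rT u) (rT v).
  have /connectP[p] := dart_connected u v; elim: p u => [|w p IH] u /=.
    by move=> _ ->.
  move=> /andP[/existsP[d /andP[/eqP <- /eqP <-]] pp] vE.
  by apply: connect_trans (IH _ pp vE); apply: step (dart_triangle_vertex d).
have toT x : exists u, connect e x (rT u).
  case: x => [[u|d]|f]; first by exists u.
  - by exists (dst d); apply: step (dart_triangle_corner d).
  - have [d <-] := face_surj f; exists (dst d); apply: (@connect_trans _ _ (rC d)).
      exact: step (dart_triangle_rot (dart_triangle_rot (dart_triangle_face d))).
    exact: step (dart_triangle_corner d).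
have [u au] := toT a; have [v bv] := toT b.
by apply: connect_trans au (connect_trans (TT u v) _); rewrite esym.
Qed.

(** Every point of the link is joined to one fixed point. At a graph vertex, each step of the
    rotation passes from one neighbour to the next through two corners; at a corner the fixed point
    is the face centre; at a face centre, the corners form one orbit of [phi]. *)
Lemma dart_triangle_link v a b c d :
  dart_triangle v a c -> dart_triangle v b d ->
  connect (fun x y => dart_triangle v x y || dart_triangle v y x) a b.
Proof.
set e := (X in connect X).
have esym : connect_sym e.
  by apply: sym_connect_sym => x y; rewrite /e orbC.
have step x y : dart_triangle v x y -> connect e x y.
  by move=> h; apply: connect1; rewrite /e h.
have step' x y : dart_triangle v x y -> connect e y x by rewrite esym; exact: step.
suff [x X] : exists x, forall a c, dart_triangle v a c -> connect e a x.
  by move=> /X ax /X bx; apply: connect_trans ax _; rewrite esym.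
case: v @e esym step step' => [[u|k]|f] e esym step step'.
- have darts_u i j : src i = u -> src j = u -> connect e (rT (dst i)) (rT (dst j)).
    move=> iu ju; have /connectP[p] : connect (fun x y => y == phi (rev x)) i j.
      by apply: rotation; rewrite iu.
    elim: p i iu => [|k p IH] i iu /=; first by move=> _ ->.
    move=> /andP[/eqP-> pp] jE.
    apply: connect_trans (IH _ _ pp jE); last by rewrite src_phi revK.
    apply: (@connect_trans _ _ (rC (rev i))).
      by apply: step'; rewrite /= revK iu !eqxx.
    apply: (@connect_trans _ _ (rC (phi (rev i)))).
      by apply: step'; rewrite /= revK iu !eqxx.
    by apply: step'; rewrite /= src_phi revK iu !eqxx.
  have [i iu] := src_surj u; exists (rT (dst i)).
  move=> [[x|x]|x] [[y|y]|y] //= /andP[/eqP h1 /eqP h2].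
  + by rewrite h2; apply: darts_u.
  + have := darts_u (rev x) i; rewrite revK -h2 => /(_ erefl iu); apply: connect_trans.
    by apply: step; rewrite /= h2 !eqxx.
  + have sx : src x = u by rewrite h2 src_phi h1.
    apply: connect_trans (darts_u x i sx iu).
    by apply: step'; rewrite /= sx !eqxx.
- exists (rF (face k)).
  have Cphi : connect e (rC (phi k)) (rF (face k)).
    by apply: step; rewrite /= !eqxx.
  have dstF : connect e (rT (dst k)) (rF (face k)).
    by apply: connect_trans Cphi; apply: step; rewrite /= !eqxx.
  move=> [[x|x]|x] [[y|y]|y] //= /andP[/eqP h1 /eqP h2].
  + by apply: connect_trans dstF; apply: step; rewrite /= h1 !eqxx.
  + by rewrite h1.
  + by apply: step'; rewrite /= h2 face_phi !eqxx.
  + by rewrite h1.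
  + by rewrite h2 -face_phi -h1.
- have [k0 k0f] := face_surj f; exists (rC k0).
  move=> [[x|x]|x] [[y|y]|y] //= /andP[/eqP h1 /eqP h2].
  have /porbitP[i ->] : k0 \in porbit phi x by apply: face_orbit; rewrite k0f.
  elim: i => [|i IH]; first by rewrite expg0 perm1.
  apply: connect_trans IH _; apply: step.
  rewrite /= expgSr permM eqxx h2 /=; apply/eqP.
  by elim: i => [|i ->]; rewrite ?expg0 ?perm1 // expgSr permM face_phi.
Qed.

(** Each of the nine patterns of [dart_triangle] is parametrised by a dart that determines the other
    two entries; [S1], [S2] and [S3] treat the three positions of that dart. *)
Lemma dart_triangle_count :
  #|[set p : W * W * W | dart_triangle p.1.1 p.1.2 p.2]| = 9 * #|D|.
Proof.
have S1 (A B : finType) (f : D -> A) (g : D -> B) :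
    \sum_d \sum_a \sum_b nat_of_bool ((a == f d) && (b == g d)) = #|D|.
  rewrite -sum1_card; apply: eq_bigr => d _.
  rewrite (bigD1 (f d)) //= (bigD1 (g d)) //= !eqxx !big1 // => [a /negPf-> //|b /negPf-> //].
  by rewrite big1.
have S2 (A B : finType) (f : D -> A) (g : D -> B) :
    \sum_a \sum_b \sum_d nat_of_bool ((a == f d) && (b == g d)) = #|D|.
  by under eq_bigr do rewrite exchange_big; rewrite exchange_big S1.
have S3 (A B : finType) (f : D -> A) (g : D -> B) :
    \sum_b \sum_d \sum_a nat_of_bool ((a == f d) && (b == g d)) = #|D|.
  by rewrite exchange_big -[RHS](S1 _ _ f g); apply: eq_bigr => d _; rewrite exchange_big.
have sumW (G : W -> nat) :
    \sum_w G w = \sum_u G (rT u) + \sum_d G (rC d) + \sum_f G (rF f).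
  by rewrite !big_sumType.
have -> : #|[set p : W * W * W | dart_triangle p.1.1 p.1.2 p.2]| =
    \sum_a \sum_b \sum_c nat_of_bool (dart_triangle a b c).
  rewrite pair_bigA pair_bigA -sum1dep_card big_mkcond /=.
  by apply: eq_bigr => p _; case: dart_triangle.
have sumW1 (I : finType) (G : I -> W -> nat) : \sum_i \sum_w G i w =
    \sum_i \sum_u G i (rT u) + \sum_i \sum_d G i (rC d) + \sum_i \sum_f G i (rF f).
  by rewrite -!big_split; apply: eq_bigr => i _; exact: sumW.
have sumW2 (I J : finType) (G : I -> J -> W -> nat) : \sum_i \sum_j \sum_w G i j w =
    \sum_i \sum_j \sum_u G i j (rT u) + \sum_i \sum_j \sum_d G i j (rC d)
    + \sum_i \sum_j \sum_f G i j (rF f).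
  by rewrite -!big_split; apply: eq_bigr => i _; exact: sumW1.
have S0 (A B C : finType) : \sum_(a : A) \sum_(b : B) \sum_(c : C) 0 = 0.
  by rewrite big1 // => a _; rewrite big1 // => b _; rewrite big1.
rewrite sumW2 !sumW1 !sumW /= !S0 !S1 !S2 !S3. move: #|D| => n; lia.
Qed.

Lemma dart_surface : 0 < #|T| ->
  closed_surface_complex (triangle_complex dart_triangle) /\
  orientable_complex (triangle_complex dart_triangle).
Proof.
move=> T0; split; last first.
  apply: triangle_complex_orientable; [exact: dart_triangle_rot |
    exact: dart_triangle_uniq | exact: dart_triangle_neq | exact: dart_triangle_chiral].
apply: triangle_complex_closed_surface; [exact: dart_triangle_rot |
    exact: dart_triangle_uniq | exact: dart_triangle_opp |
    exact: dart_triangle_neq | exact: dart_triangle_chiral |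
    exact: dart_triangle_cover | | exact: dart_triangle_connected |
    exact: dart_triangle_link].
by rewrite !card_sum -addnA ltn_addr.
Qed.

(** With T + D + F vertices and 9D oriented triples, the Euler characteristic is (T + D + F) - 9D/6
    = T - D/2 + F, that of the cell decomposition itself. *)
Lemma dart_surface_euler :
  (euler_char (triangle_complex dart_triangle) *+ 2 =
     (#|T| + #|F|)%:R *+ 2 - #|D|%:R :> int)%R.
Proof.
have := @triangle_complex_euler _ _ dart_triangle_rot dart_triangle_uniq
  dart_triangle_opp dart_triangle_neq dart_triangle_chiral dart_triangle_cover.
rewrite dart_triangle_count !card_sum.
move: (euler_char _) #|T| #|D| #|F| => x t d f; lia.
Qed.

Lemma dart_surface_embeds (R : realType) (e : rel T) (g : nat) :
  0 < #|T| -> (forall u v, e u v -> exists2 d, src d = u & dst d = v) ->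
  #|T|.*2 + #|F|.*2 + 4 * g = #|D| + 4 -> embeds_in_genus R e g.
Proof.
move=> T0 eD gE; have [surf ori] := dart_surface T0.
exists (polyhedron R (triangle_complex dart_triangle)); split.
  exists W, (triangle_complex dart_triangle); split=> //.
    move: dart_surface_euler gE.
    by move: (euler_char _) #|T| #|D| #|F| => x t d f; lia.
  by exists id, id; split=> // x; exact: cvg_id.
apply: (@subcomplex_embedding R T W (fun u => rT u)) => [u v [] //|s].
rewrite inE => /orP[/cards1P[u ->]|/existsP[u /existsP[v /andP[uv /eqP->]]]].
  by have [[_ + _] _ _ _ _] := surf; rewrite imset_set1.
have [d <- <-] := eD _ _ uv.
rewrite imsetU1 imset_set1; exact: oriented_edge_mem (dart_triangle_vertex d).
Qed.

End RotationSystem.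

(** * Cycles of a permutation and the genus of a rotation system *)

(** An orbit of length l receives the weight 1/l exactly l times. *)
Lemma card_porbits_weight (T : finType) (s : {perm T}) :
  #|porbits s|%:R = \sum_x #|porbit s x|%:R^-1 :> rat.
Proof.
rewrite (partition_big (porbit s) (mem (porbits s))) /=; last first.
  by move=> x _; exact: imset_f.
rewrite -sum1_card natr_sum; apply: eq_bigr => A /imsetP[y _ ->].
rewrite (eq_bigl (fun x => x \in porbit s y)) => [|x]; last exact: eq_porbit_mem.
rewrite (eq_bigr (fun=> #|porbit s y|%:R^-1)) => [|x]; last first.
  by rewrite -eq_porbit_mem => /eqP->.
by rewrite sumr_const -[RHS]mulr_natl mulfV // pnatr_eq0 card_porbit_neq0.
Qed.

Lemma porbit_card_le (T : finType) (s : {perm T}) x k :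
  (0 < k)%N -> iter k s x = x -> (#|porbit s x| <= k)%N.
Proof.
move=> k0 E; rewrite leqNgt; apply/negP => kc.
have := uniq_traject_porbit s x; move/(uniqP x)/(_ 0%N k); rewrite !inE size_traject.
rewrite nth_traject ?(leq_trans _ kc) // nth_traject // E => /(_ isT isT erefl) k0E.
by rewrite -k0E in k0.
Qed.

Section RotationGenus.
Local Open Scope nat_scope.
Local Open Scope set_scope.
Variables (T D : finType) (src : D -> T) (rev : D -> D) (phi : {perm D}).
Local Notation dst d := (src (rev d)).

Hypothesis revK : involutive rev.
Hypothesis dart_inj : forall d e, src d = src e -> dst d = dst e -> d = e.
Hypothesis src_neq_dst : forall d, src d != dst d.
Hypothesis src_phi : forall d, src (phi d) = dst d.
Hypothesis phi2_neq : forall d, phi (phi d) != d.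
Hypothesis src_surj : forall v, exists d, src d = v.
Hypothesis rotation : forall d e, src d = src e ->
  connect (fun x y => y == phi (rev x)) d e.
Hypothesis dart_connected : forall u v,
  connect (fun x y => [exists d, (src d == x) && (dst d == y)]) u v.

(* With E := #|D| / 2 the parity of the Euler characteristic V - E + F follows
   from multiplicativity of the signature: the rotation, with V cycles, is the
   product of [rev], with E cycles, and [phi], with F cycles. *)
Lemma rotation_parity k : #|D| = k.*2 -> odd (#|T| + #|porbits phi| + k) = false.
Proof.
move=> Dk; pose revp := perm (inv_inj revK).
have rev_neq d : rev d != d.
  by apply: contraNneq (src_neq_dst d) => ->.
have card_rev : #|porbits revp| = k.
  have orb d : #|porbit revp d| = 2.
    suff -> : porbit revp d = [set d; rev d] by rewrite cards2 eq_sym rev_neq.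
    apply/setP => x; rewrite !inE; apply/idP/orP => [/porbitP[i ->]|[]/eqP->].
    - elim: i => [|i IH]; first by rewrite expg0 perm1 eqxx; left.
      rewrite expgSr permM permE; case: IH => /eqP->; first by rewrite eqxx; right.
      by rewrite revK eqxx; left.
    - exact: porbit_id.
    - by have := mem_porbit revp 1 d; rewrite expg1 permE.
  apply/eqP; rewrite -(eqr_nat rat) card_porbits_weight.
  under eq_bigr do rewrite orb.
  by rewrite sumr_const -[X in X == _]mulr_natl Dk -muln2 natrM mulfK.
have card_rot : #|porbits (revp * phi)%g| = #|T|.
  have orb d : porbit (revp * phi)%g d = [set x | src x == src d].
    apply/setP => x; rewrite inE; apply/idP/eqP => [/porbitP[i ->]|xd].
      elim: i => [|i IH]; first by rewrite expg0 perm1.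
      by rewrite expgSr !permM permE src_phi revK.
    have /connectP[p pp ->] := rotation (esym xd).
    elim: p d pp {xd} => [|y p IH] d /=; first by rewrite porbit_id.
    move=> /andP[/eqP-> pp]; rewrite -(porbit_perm _ 1) expg1 permM permE.
    exact: IH.
  have <- : #|[set [set x | src x == u] | u : T]| = #|T|.
    rewrite card_imset // => u v /setP uv; have [d du] := src_surj u.
    by have := uv d; rewrite !inE du eqxx => /esym/eqP.
  apply: eq_card => A; apply/imsetP/imsetP => -[].
    by move=> d _ ->; exists (src d).
  by move=> u _ ->; have [d <-] := src_surj u; exists d.
have := odd_permM revp phi.
(* [odd_perm] is the parity of [#|D|] plus the number of cycles, and [#|D|] is even. *)
rewrite /odd_perm card_rev card_rot Dk odd_double !oddD.
by case: odd; case: odd; case: odd.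
Qed.

Lemma rotation_genus (R : realType) (e : rel T) k :
  0 < #|T| -> (forall u v, e u v -> exists2 d, src d = u & dst d = v) ->
  #|D| = k.*2 -> #|T| + #|porbits phi| <= k ->
  exists2 g, embeds_in_genus R e g & #|T| + #|porbits phi| + g.*2 = k + 2.
Proof.
move=> T0 eD Dk Tk.
pose F : finType := {A : {set D} | A \in porbits phi}.
have mem_porbits d : porbit phi d \in porbits phi by exact: imset_f.
pose face d : F := exist _ (porbit phi d) (mem_porbits d).
have FE : #|F| = #|porbits phi| by rewrite card_sig; apply: eq_card => A; rewrite inE.
have par := rotation_parity Dk.
(* The difference is even by [rotation_parity] and is not truncated, so the halving is exact. *)
exists ((k + 2 - (#|T| + #|porbits phi|))./2); last first.
  by move: par Tk; lia.
have face_phi d : face (phi d) = face d.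
  by apply: val_inj => /=; have := porbit_perm phi 1 d; rewrite expg1.
have face_orbit d d' : face d = face d' -> d' \in porbit phi d.
  by move=> /(congr1 val) /= ->; exact: porbit_id.
have face_surj f : exists d, face d = f.
  by case: f => A /[dup] /imsetP[d _ AE] AF; exists d; apply: val_inj.
apply: (@dart_surface_embeds T D F src rev phi face) => //.
by rewrite FE Dk; move: par Tk; lia.
Qed.

End RotationGenus.

(** * The pancake graph *)

Section Pancake.
Local Open Scope nat_scope.
Variables (m n : nat).
Hypotheses (m_gt2 : 2 < m) (n_gt1 : 1 < n).
Local Notation word := (signed_perm m n).
Local Notation adj := (@pancake_adj m n).
Implicit Types (v w : word) (i j : 'I_n).

Let z0 : 'I_n := Ordinal (ltnW n_gt1).

(** * Flips and connectedness *)

Lemma rev_prefix_gt i j : i < j -> rev_prefix i j = j.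
Proof. by move=> ij; apply: val_inj; rewrite permE /= leqNgt ij. Qed.

Lemma rev_prefix0 i : rev_prefix i z0 = i.
Proof. by apply: val_inj; rewrite permE /= subn0. Qed.

Lemma rev_prefixx i : rev_prefix i i = z0.
Proof. by apply: val_inj; rewrite permE /= leqnn subnn. Qed.

Lemma rev_prefixK i : involutive (rev_prefix i).
Proof.
move=> j; apply: val_inj; rewrite !permE /=.
by have [ji|ij] := leqP j i; rewrite ?leq_subr ?subKn // leqNgt ij.
Qed.

Lemma flip_perm i w j : (flip i w).1 j = w.1 (rev_prefix i j).
Proof. by rewrite permM. Qed.

Lemma flip_sign i w j :
  (flip i w).2 j = if j <= i then (w.2 (rev_prefix i j) + 1)%R else w.2 j.
Proof. by rewrite ffunE. Qed.

Lemma flip_inj i : injective (@flip m n i).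
Proof.
move=> [p a] [q b] /= [/mulgI -> /ffunP ab]; congr pair; apply/ffunP => j.
have := ab (rev_prefix i j); rewrite !ffunE rev_prefixK.
have [ji|ij] := leqP j i; last by rewrite rev_prefix_gt // leqNgt ij.
by rewrite permE /= ji leq_subr => /addIr.
Qed.

Definition flip_p i : {perm word} := perm (@flip_inj i).

Lemma Zm_dvd k : (k%:R == 0 :> 'Z_m)%R = (m %| k).
Proof. by rewrite -val_eqE /= val_Zp_nat // ltnW. Qed.

Lemma flip_idx_inj i j w : flip i w = flip j w -> i = j.
Proof.
move=> /(congr1 (fun u : word => u.1 z0)); rewrite !flip_perm !rev_prefix0.
exact: perm_inj.
Qed.

(** The letter brought to position j is [w.1 i], so equality would give i = j; but then the first
    sign has grown by 2, which is nonzero modulo m > 2. *)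
Lemma flip2_neq i j w : flip j (flip i w) != w.
Proof.
apply/eqP => E; have ij : i = j.
  have := congr1 (fun u : word => u.1 j) E; rewrite !flip_perm rev_prefixx rev_prefix0.
  exact: perm_inj.
have := congr1 (fun u : word => u.2 z0) E.
rewrite ij !flip_sign leq0n rev_prefix0 leqnn rev_prefixx -addrA.
rewrite -[RHS]addr0 => /addrI /eqP; rewrite -[(1 + 1)%R]/(2%:R)%R Zm_dvd => /dvdn_leq.
by move=> /(_ isT); rewrite leqNgt m_gt2.
Qed.

(** Each flip exchanges the letters at positions 0 and i and raises both signs by 1. Following these
    two positions gives the divisibility conditions on a period. *)
Lemma iter_flip k i w :
  [/\ (iter k (flip i) w).1 z0 = w.1 (if odd k then i else z0),
      (iter k (flip i) w).1 i = w.1 (if odd k then z0 else i),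
      (iter k (flip i) w).2 z0 = (w.2 (if odd k then i else z0) + k%:R)%R
    & (iter k (flip i) w).2 i = (w.2 (if odd k then z0 else i) + k%:R)%R].
Proof.
elim: k => [|k [h1 h2 h3 h4]]; first by rewrite /= !addr0.
rewrite !iterS !flip_perm !flip_sign leq0n leqnn rev_prefix0 rev_prefixx h1 h2 h3 h4.
by rewrite -natr1 !addrA /=; case: odd.
Qed.

Lemma iter_flip_period k i w : iter k (flip i) w = w ->
  (m %| k) && ((i != z0) ==> ~~ odd k).
Proof.
move=> E; have [h1 _ h3 _] := iter_flip k i w; rewrite E in h1 h3.
have idx := perm_inj h1; rewrite -idx in h3.
move: h3; rewrite -{1}[w.2 z0]addr0 => /addrI /esym/eqP; rewrite Zm_dvd => -> /=.
by apply/implyP; case: odd idx => // ->; rewrite eqxx.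
Qed.

(** Two equal flips restore the order of the letters and add 2 to each sign of the prefix. *)
Lemma iter_flip_even k i w :
  iter k.*2 (flip i) w =
  (w.1, [ffun j : 'I_n => if j <= i then (w.2 j + k.*2%:R)%R else w.2 j]).
Proof.
elim: k => [|k IH].
  by rewrite /=; case: w => p a; congr pair; apply/ffunP => j; rewrite ffunE addr0 if_same.
rewrite doubleS !iterS {}IH; congr pair.
  by apply/permP => j /=; rewrite !permM /= rev_prefixK.
apply/ffunP => j; rewrite !ffunE /=; case: (leqP j i) => // ji.
have rji : rev_prefix i j <= i by rewrite permE /= ji leq_subr.
by rewrite rji ?ffunE rev_prefixK ji /= -!natr1 !addrA.
Qed.

Lemma iter_flip_id i w : ~~ odd m -> iter m (flip i) w = w.
Proof.
move=> me; have mE : m./2.*2 = m by rewrite halfK (negPf me) subn0.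
have := iter_flip_even m./2 i w; rewrite mE => ->.
have -> : (m%:R = 0 :> 'Z_m)%R by apply/eqP; rewrite Zm_dvd.
by case: w => p a /=; congr pair; apply/ffunP => j; rewrite ffunE addr0 if_same.
Qed.

Lemma pancake_adj_sym v w : adj v w = adj w v.
Proof. by apply: eq_existsb => i; rewrite orbC. Qed.

Lemma adj_flip i w : adj w (flip i w).
Proof. by apply/existsP; exists i; rewrite eqxx. Qed.

(* Letters are put in place from position n-1 down to 0: letter K is flipped to
   the front, its sign is turned to -1 with [flip z0], and [flip K] moves it to
   position K with sign 0. *)
Lemma pancake_connect_id w : connect adj w ((1%g, [ffun=> 0%R]) : word).
Proof.
suff H k : k <= n -> forall w, (forall j : 'I_n, k <= j -> w.1 j = j /\ w.2 j = 0%R) ->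
    connect adj w ((1%g, [ffun=> 0%R]) : word).
  by apply: (H n) => // j; rewrite leqNgt ltn_ord.
elim: k => [_ {}w fixw|k IH kn {}w fixw].
  suff -> : w = (1%g, [ffun=> 0%R]) by [].
  case: w fixw => p a fixw; congr pair.
    by apply/permP => j; rewrite perm1; have [] := fixw j isT.
  by apply/ffunP => j; rewrite ffunE; have [] := fixw j isT.
pose K := Ordinal kn; pose j := (w.1^-1)%g K.
have jk : j <= k.
  rewrite leqNgt; apply/negP => kj; have [jE _] := fixw j kj.
  by move: jE kj; rewrite permKV => <-; rewrite ltnn.
(* [t] is the natural representative of -1 minus the first sign; each [flip z0] only adds 1 to that
   sign. *)
pose w1 := flip j w; pose t : nat := (- 1 - w1.2 z0)%R.
have it s : [/\ connect adj w1 (iter s (flip z0) w1),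
    (iter s (flip z0) w1).1 = w1.1,
    (iter s (flip z0) w1).2 z0 = (w1.2 z0 + s%:R)%R
  & forall l : 'I_n, 0 < l -> (iter s (flip z0) w1).2 l = w1.2 l].
  elim: s => [|s [h1 h2 h3 h4]]; first by split; rewrite /= ?addr0.
  rewrite iterS; split.
  - by apply: connect_trans h1 (connect1 _); exact: adj_flip.
  - apply/permP => l; rewrite flip_perm h2; congr (_ _).
    have [l0|l0] := posnP l; last by rewrite rev_prefix_gt.
    by rewrite (_ : l = z0) ?rev_prefix0 //; exact: val_inj.
  - by rewrite flip_sign rev_prefix0 h3 -natr1 addrA.
  - by move=> l l0; rewrite flip_sign leqNgt l0 /= h4.
have [c2 p2 s2 r2] := it t; set w2 := iter t _ _ in c2 p2 s2 r2.
apply: (@connect_trans _ _ w1); first by apply/connect1/adj_flip.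
apply: connect_trans c2 _; apply: (@connect_trans _ _ (flip K w2)).
  by apply/connect1/adj_flip.
apply: IH => [|l]; first exact: ltnW.
rewrite leq_eqVlt => /orP[/eqP kl|kl].
  have -> : l = K by exact: val_inj.
  rewrite flip_perm flip_sign leqnn rev_prefixx p2 s2 flip_perm rev_prefix0 permKV.
  split=> //; rewrite /t natr_Zp; ring.
have [l1 l2] := fixw l kl.
have jl : j < l by exact: leq_ltn_trans kl.
rewrite flip_perm flip_sign rev_prefix_gt // p2 flip_perm rev_prefix_gt //.
rewrite leqNgt kl /= r2 ?(leq_ltn_trans _ kl) //.
by rewrite flip_sign leqNgt jl /=.
Qed.

Lemma pancake_connected v w : connect adj v w.
Proof.
apply: connect_trans (pancake_connect_id v) _.
by rewrite (sym_connect_sym pancake_adj_sym) pancake_connect_id.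
Qed.

(** * Darts of the pancake graph and their rotation *)

Local Notation dart := (word * 'I_n * bool)%type.
Local Notation src d := (d.1.1).

Definition dart_rev (d : dart) : dart :=
  let: (w, i, b) := d in
  (if b then flip i w else (flip_p i)^-1%g w, i, ~~ b).

Definition next_dart_fun (d : dart) : dart :=
  let: (w, i, b) := d in
  if b then (flip i w, i, true) else ((flip_p i)^-1%g w, ordS i, false).

Lemma next_dart_inj : injective next_dart_fun.
Proof.
move=> [[v i] b] [[w j] c]; case: b; case: c => //= /pair_equal_spec[] /pair_equal_spec[vw ij] _.
  by move: vw; rewrite ij => /flip_inj->.
by move: vw; rewrite (can_inj (@ordSK n) ij) => /perm_inj->.
Qed.

(* The faces to the left of the darts (w, i, true) are the cycles of [flip i]. *)
Definition next_dart : {perm dart} := perm next_dart_inj.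

Lemma dart_revK : involutive dart_rev.
Proof.
move=> [[w i] []] /=; first by rewrite -[flip i w](permE (@flip_inj i)) permK.
by rewrite -[flip i _](permE (@flip_inj i)) permKV.
Qed.

Lemma flip_invE i v w : ((flip_p i)^-1%g v == w) = (v == flip i w).
Proof. by rewrite -(inj_eq (@perm_inj _ (flip_p i))) permKV permE. Qed.

(** For equal dart signs the index can be read off from the two ends; opposite dart signs would give
    two flips composing to a map that fixes a word, against [flip2_neq]. *)
Lemma pancake_dart_inj (d e : dart) :
  src d = src e -> src (dart_rev d) = src (dart_rev e) -> d = e.
Proof.
move: d e => [[v i] b] [[w j] c] /= <-; case: b; case: c => E.
- by rewrite (flip_idx_inj E).
- by have := flip2_neq i j v; rewrite E -[flip j _](permE (@flip_inj j)) permKV eqxx.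
- by have := flip2_neq j i v; rewrite -E -[flip i _](permE (@flip_inj i)) permKV eqxx.
- suff -> : i = j by [].
  apply: (@flip_idx_inj _ _ ((flip_p i)^-1%g v)); rewrite {2}E.
  by rewrite -[flip i _](permE (@flip_inj i)) -[flip j _](permE (@flip_inj j)) !permKV.
Qed.

Lemma pancake_src_neq_dst (d : dart) : src d != src (dart_rev d).
Proof.
case: d => [[w i] []] /=.
  by apply/eqP => E; have := flip2_neq i i w; rewrite -!E eqxx.
rewrite eq_sym flip_invE.
by apply/eqP => E; have := flip2_neq i i w; rewrite -!E eqxx.
Qed.

Lemma src_next_dart (d : dart) : src (next_dart d) = src (dart_rev d).
Proof. by case: d => [[w i] []]; rewrite permE. Qed.

Lemma next_dart2_neq d : next_dart (next_dart d) != d.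
Proof.
rewrite !permE; case: d => [[w i] []] /=; rewrite !xpair_eqE.
  by rewrite (negPf (flip2_neq _ _ _)).
by rewrite flip_invE flip_invE eq_sym (negPf (flip2_neq _ _ _)).
Qed.

Lemma iter_ordS k i : iter k (@ordS n) i = (i + k) %% n :> nat.
Proof.
elim: k => [|k IH]; first by rewrite addn0 modn_small.
by rewrite iterS /= IH -addn1 modnDml addn1 addnS.
Qed.

(** Around v the rotation sends (v, k, +) to (v, k+1, -) and (v, k, -) to (v, k, +), with k taken
    cyclically: a single alternating cycle through all 2n darts. *)
Lemma pancake_rotation (d e : dart) : src d = src e ->
  connect (fun x y => y == next_dart (dart_rev x)) d e.
Proof.
move: d e => [[v i] b] [[w j] c] /= <- {w}; set r := (X in connect X).
have turn k : connect r (v, k, true) (v, ordS k, false).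
  by apply: connect1; rewrite /r permE /= -[flip k v](permE (@flip_inj k)) permK.
have cross k : connect r (v, k, false) (v, k, true).
  by apply: connect1; rewrite /r permE /= -[flip k _](permE (@flip_inj k)) permKV.
have spin k l : connect r (v, k, true) (v, l, true).
  (* Adding n keeps the subtraction from truncating and does not change the index modulo n. *)
  have -> : l = iter (l + n - k) (@ordS n) k.
    apply: ord_inj; rewrite iter_ordS subnKC; last by rewrite ltnW // ltn_addl.
    by rewrite modnDr modn_small.
  elim: (l + n - k) => [|t IH] //=.
  exact: connect_trans IH (connect_trans (turn _) (cross _)).
have out : connect r (v, i, b) (v, i, true) by case: b.
apply: (connect_trans out); case: c; first exact: spin.
by rewrite -(ord_predK j); apply: connect_trans (turn _).
Qed.

Lemma pancake_adj_dart v w :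
  reflect (exists2 d : dart, src d = v & src (dart_rev d) = w) (adj v w).
Proof.
apply: (iffP existsP) => [[i /orP[]/eqP->]|[[[u i] []] /= <- <-]].
- by exists (v, i, true).
- by exists (flip i w, i, false); rewrite //= -[flip i w](permE (@flip_inj i)) permK.
- by exists i; rewrite eqxx.
- by exists i; rewrite orbC -flip_invE eqxx.
Qed.

Lemma pancake_dart_connected v w :
  connect (fun x y => [exists d : dart, (src d == x) && (src (dart_rev d) == y)]) v w.
Proof.
apply: connect_sub (pancake_connected v w) => x y /pancake_adj_dart[d <- <-].
by apply/connect1/existsP; exists d; rewrite !eqxx.
Qed.

(** * Lengths and number of the faces *)

Lemma card_word : #|{: word}| = m ^ n * n`!.
Proof.
rewrite card_prod card_Sn card_ffun !card_ord Zp_cast 1?mulnC //.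
exact: ltnW.
Qed.

Lemma next_dart_orbit_pos w i :
  let c := #|porbit next_dart (w, i, true)| in
  [/\ 0 < c, m %| c & (i != z0) ==> ~~ odd c].
Proof.
move=> c; have it k : iter k next_dart (w, i, true) = (iter k (flip i) w, i, true).
  by elim: k => //= k ->; rewrite permE.
have := iter_porbit next_dart (w, i, true); rewrite it => -[] /iter_flip_period/andP[].
by split=> //; rewrite lt0n card_porbit_neq0.
Qed.

(** Each step along such a face advances the index by 1 modulo n. *)
Lemma next_dart_orbit_neg w i : n %| #|porbit next_dart (w, i, false)|.
Proof.
have it k : iter k next_dart (w, i, false) =
    ((iter k next_dart (w, i, false)).1.1, iter k (@ordS n) i, false).
  by elim: k => //= k ->; rewrite permE.
have := iter_porbit next_dart (w, i, false); rewrite it => -[] _ /(congr1 (@nat_of_ord n)).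
rewrite iter_ordS => /eqP; rewrite -[X in _ == X](modn_small (ltn_ord i)).
by rewrite -{2}[i : nat]addn0 eqn_modDl mod0n.
Qed.

Lemma next_dart_orbit_ge3 d : 2 < #|porbit next_dart d|.
Proof.
have := iter_porbit next_dart d; have := card_porbit_neq0 next_dart d.
case: #|_| => [|[|[|//]]] //= _ E.
  by have := pancake_src_neq_dst d; rewrite -src_next_dart E eqxx.
by have := next_dart2_neq d; rewrite E eqxx.
Qed.

Lemma next_dart_orbit_le w i : ~~ odd m -> #|porbit next_dart (w, i, true)| <= m.
Proof.
move=> me; apply: porbit_card_le; first exact: ltnW (ltnW m_gt2).
have it k : iter k next_dart (w, i, true) = (iter k (flip i) w, i, true).
  by elim: k => //= k ->; rewrite permE.
by rewrite it iter_flip_id.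
Qed.

(** The number of faces is the sum over darts of the reciprocal face lengths, so it suffices to
    bound this sum over the 2n darts at a vertex by n - 1. *)
Lemma next_dart_orbits_le : #|porbits next_dart| <= n.-1 * #|{: word}|.
Proof.
have inv_le (c a : nat) : 0 < a -> a <= c -> (c%:R^-1 <= a%:R^-1 :> rat)%R.
  by move=> a0 ac; rewrite lef_pV2 ?ler_nat // posrE ltr0n // (leq_trans a0).
rewrite -(ler_nat rat) card_porbits_weight.
(* For n >= 3, face length at least 3 is enough, since 2n/3 <= n - 1. *)
have [n3|n2] := leqP 3 n.
  have le3 (d : dart) : (#|porbit next_dart d|%:R^-1 <= 3%:R^-1 :> rat)%R.
    exact: inv_le (next_dart_orbit_ge3 d).
  apply: le_trans (ler_sum _ (fun d _ => le3 d)) _.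
  rewrite sumr_const !card_prod card_bool card_ord -[leLHS]mulr_natl ler_pdivrMr ?ltr0n //.
  by rewrite -natrM ler_nat -!mulnA; move: #|_| => V; case: (n) n3 => // n'; nia.
have {n2} n2 : n = 2 by apply/eqP; rewrite eqn_leq -ltnS n2.
(* For n = 2, negative faces have even length, hence at least 4. Positive ones have length at least
   m >= 4 for even m; for odd m, at least 3 when i = 0, and otherwise an even multiple of m, hence
   at least 6. The reciprocals sum to 4/4 or to 1/3 + 1/6 + 2/4, both equal to 1. *)
pose b (i : 'I_n) (c : bool) : rat :=
  (if ~~ c || ~~ odd m then 4 else if i == z0 then 3 else 6)%:R^-1%R.
have le_b (d : dart) : (#|porbit next_dart d|%:R^-1 <= b d.1.2 d.2)%R.
  apply: inv_le; first by case: ifP => //; case: ifP.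
  case: d => [[w i] [] /=]; last first.
    have := next_dart_orbit_ge3 (w, i, false); have := next_dart_orbit_neg w i.
    by rewrite {1}n2; case: #|_| => [|[|[|[|k]]]].
  have [c0 /dvdnP[q cE]] := next_dart_orbit_pos w i.
  have := next_dart_orbit_ge3 (w, i, true).
  move: c0; rewrite {}cE => c0 ge3 /implyP ieven.
  have q0 : 0 < q by case: (q) c0.
  have [mo|me] /= := boolP (odd m); last first.
    have m4 : 3 < m by rewrite ltn_neqAle m_gt2 andbT; apply: contraNneq me => <-.
    by rewrite (leq_trans m4) // leq_pmull.
  case: eqVneq ieven => [_ _|_ /(_ isT)]; first by rewrite (leq_trans m_gt2) // leq_pmull.
  rewrite oddM mo andbT => qe.
  have q2 : 1 < q by case: (q) q0 qe => [|[|]].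
  by rewrite (@leq_mul 2 3).
apply: le_trans (ler_sum _ (fun d _ => le_b d)) _.
rewrite -(pair_bigA _ (fun p c => b p.2 c)) /= -(pair_bigA _ (fun w i => \sum_c b i c)%R) /=.
rewrite sumr_const -[leLHS]mulr_natl mulrC natrM ler_wpM2r ?ler0n //.
have -> : (\sum_i \sum_c b i c)%R =
    (b z0 true + b z0 false + (b (ordS z0) true + b (ordS z0) false))%R.
  rewrite (bigD1 z0) //= (bigD1 (ordS z0)) /=; last first.
    by rewrite -val_eqE /= modn_small.
  rewrite [X in (_ + (_ + X))%R]big1 ?addr0 ?big_bool // => -[i lti] /andP[].
  by rewrite -!val_eqE /= modn_small //; case: i lti => [|[|i]] // lti; have := lti; rewrite {1}n2.
have -> : n.-1 = 1 by rewrite n2.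
have z1 : (ordS z0 == z0) = false by rewrite -val_eqE /= modn_small.
rewrite /b eqxx z1 /=.
by case: odd => /=; lra.
Qed.

(** Each of the nV positive darts has weight at least 1/m; the weights of the negative darts are
    merely bounded below by 0. *)
Lemma next_dart_orbits_ge : ~~ odd m ->
  (n%:R * #|{: word}|%:R / m%:R <= #|porbits next_dart|%:R :> rat)%R.
Proof.
move=> me; rewrite card_porbits_weight.
rewrite (eq_bigr (fun d => #|porbit next_dart (d.1, d.2)|%:R^-1%R)) => [|[] //].
rewrite -(pair_bigA _ (fun p c => #|porbit next_dart (p, c)|%:R^-1 : rat)%R) /=.
have le1 (p : word * 'I_n) :
    (m%:R^-1 <= \sum_c #|porbit next_dart (p, c)|%:R^-1 :> rat)%R.
  rewrite big_bool /= -[leLHS]addr0; apply: lerD; last by rewrite invr_ge0.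
  case: p => w i; rewrite lef_pV2 ?posrE ?ltr0n ?ler_nat ?next_dart_orbit_le //.
    exact: ltnW (ltnW m_gt2).
  by have [] := next_dart_orbit_pos w i.
apply: le_trans (ler_sum _ (fun p _ => le1 p)).
by rewrite sumr_const (card_prod word 'I_n) card_ord -[leRHS]mulr_natl natrM [(n%:R * _)%R]mulrC.
Qed.

Lemma pancake_embeds (R : realType) : exists2 g, embeds_in_genus R adj g &
  #|{: word}| + #|porbits next_dart| + g.*2 = n * #|{: word}| + 2.
Proof.
apply: (@rotation_genus word dart (fun d => src d) dart_rev next_dart).
- exact: dart_revK.
- exact: pancake_dart_inj.
- exact: pancake_src_neq_dst.
- exact: src_next_dart.
- exact: next_dart2_neq.
- by move=> v; exists (v, z0, true).
- exact: pancake_rotation.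
- exact: pancake_dart_connected.
- by rewrite card_word muln_gt0 expn_gt0 fact_gt0 (ltnW (ltnW m_gt2)).
- by move=> u v /pancake_adj_dart.
- by rewrite (card_prod (word * 'I_n)%type bool) (card_prod word 'I_n)
    card_bool card_ord muln2 mulnC.
- rewrite -[X in _ <= X * _](prednK (ltnW n_gt1)) mulSn leq_add2l.
  exact: next_dart_orbits_le.
Qed.

End Pancake.

(** * The genus bound *)

Lemma is_genus_min (R : realType) (T : finType) (e : rel T) (g : nat) :
  embeds_in_genus R e g -> exists2 h, is_genus R e h & (h <= g)%N.
Proof.
move=> eg; have ex : exists k, `[< embeds_in_genus R e k >] by exists g; apply/asboolP.
case: (ex_minnP ex) => h /asboolP eh hmin; exists h; last exact/hmin/asboolP.
by split=> // k /asboolP /hmin.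
Qed.

Theorem theorem4p14 (R : realType) (m n : nat) (hm : (3 <= m)%N) (hn : (2 <= n)%N) :
  exists2 g : nat, is_genus R (@pancake_adj m n) g &
    g%:R <= (if ~~ odd m then
               1 / 2 * m%:R ^+ (n - 1) * (m%:R * n%:R - m%:R - n%:R)
                 * (n`!)%:R + 1
             else
               1 / 2 * m%:R ^+ (n - 1)
                 * (2 * m%:R * n%:R - 2 * m%:R - n%:R - 1)
                 * (n`!)%:R + 1) :> rat.
Proof.
have [g0 eg0 E] := pancake_embeds hm hn R.
have [g gg gle] := is_genus_min eg0; exists g => //.
have {gle} : g%:R <= g0%:R :> rat by rewrite ler_nat.
have ge := next_dart_orbits_ge hm hn.
move: E ge; move: #|porbits _| => F; rewrite card_word //.
have m0 : m%:R != 0 :> rat by rewrite pnatr_eq0 -lt0n (leq_trans _ hm).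
rewrite (_ : m ^ n = m * m ^ (n - 1))%N; last by rewrite -expnS subn1 prednK // ltnW.
(* There are mU vertices, so the relation becomes mU + F + 2g = nmU + 2 and both bounds are linear
   in U. *)
set U := (m ^ (n - 1) * n`!)%N.
have -> : (m * m ^ (n - 1) * n`! = m * U)%N by rewrite mulnA.
have UE : U%:R = m%:R ^+ (n - 1) * (n`!)%:R :> rat by rewrite natrM natrX.
clearbody U; have U0 : 0 <= U%:R :> rat by [].
move=> /(congr1 (fun k => k%:R : rat)) E ge gle.
rewrite -muln2 !natrD !natrM in E.
have F0 : 0 <= F%:R :> rat by [].
have m3 : 3 <= m%:R :> rat by rewrite ler_nat.
have n2 : 2 <= n%:R :> rat by rewrite ler_nat.
have -> : 1 / 2 * m%:R ^+ (n - 1) * (m%:R * n%:R - m%:R - n%:R) * (n`!)%:R + 1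
  = 1 / 2 * U%:R * (m%:R * n%:R - m%:R - n%:R) + 1 :> rat by rewrite UE; ring.
have -> : 1 / 2 * m%:R ^+ (n - 1) * (2 * m%:R * n%:R - 2 * m%:R - n%:R - 1) * (n`!)%:R + 1
  = 1 / 2 * U%:R * (2 * m%:R * n%:R - 2 * m%:R - n%:R - 1) + 1 :> rat by rewrite UE; ring.
case: ifP => [/ge|_].
  (* For even m this gives F >= nU, hence 2g <= U(mn - m - n) + 2. *)
  rewrite natrM (_ : n%:R * (m%:R * U%:R) / m%:R = n%:R * U%:R) => [{}ge|]; last by field.
  nra.
(* For odd m, F >= 0 gives 2g <= Um(n - 1) + 2. Twice the claimed bound exceeds this by U(mn - m - n
   - 1) = U((m - 1)(n - 1) - 2), which is nonnegative. *)
have : 0 <= U%:R * ((m%:R - 1) * (n%:R - 1) - 2) :> rat.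
  by apply: mulr_ge0 => //; nra.
nra.
Qed.
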